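(* Let $(\mathfrak{g},\langle\cdot,\cdot\rangle)$ be a pseudo-Riemannian almost-abelian Lie algebra of dimension $n$ admitting a non-degenerate abelian ideal $\mathfrak{a}$ of codimension one. Let $e$ be a unit generator of $\mathfrak{a}^{\perp}$ (so $\langle e,e\rangle\in\{1,-1\}$), and suppose that the symmetric part of $\operatorname{ad}_e$ with respect to $\langle\cdot,\cdot\rangle$ is non-zero. Then the symmetric part $U$ of the Levi-Civita connection defines an associative product on $\mathfrak{g}$ if and only if $(\mathfrak{g},\langle\cdot,\cdot\rangle)$ is isometrically isomorphic to a direct product $$(\mathfrak{h}_3,\langle\cdot,\cdot\rangle_1)\times(\mathbb{R}^{n-3},\langle\cdot,\cdot\rangle_2),$$ where: (1) $\mathfrak{h}_3=\operatorname{span}\{E,F,Z\}$ is the $3$-dimensional real Heisenberg algebra (with only non-zero bracket $[E,F]=Z$ up to skew-symmetry), equipped with the pseudo-metric $\langle\cdot,\cdot\rangle_1$ given by $\langle E,E\rangle_1=\pm1$ (for one of the two signs), $\langle F,Z\rangle_1=1$, and all other inner products of basis vectors equal to zero; (2) $\mathbb{R}^{n-3}$ is regarded as an abelian Lie algebra and $\langle\cdot,\cdot\rangle_2$ is a non-degenerate metric on it such that the total signature of the product is the signature of $\langle\cdot,\cdot\rangle$.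
   Context: A pseudo-Riemannian Lie algebra $(\mathfrak{g},\langle\cdot,\cdot\rangle)$ is a finite-dimensional real Lie algebra $\mathfrak{g}$ with a nondegenerate symmetric bilinear form $\langle\cdot,\cdot\rangle$ (of arbitrary signature). An almost-abelian Lie algebra is a non-abelian Lie algebra containing an abelian ideal of codimension one. A subspace is non-degenerate if the restriction of $\langle\cdot,\cdot\rangle$ to it is nondegenerate. The symmetric part of a linear map $Q$ with respect to $\langle\cdot,\cdot\rangle$ is $\frac12(Q+Q^{\dagger})$, where $Q^\dagger$ is the adjoint defined by $\langle QX,Y\rangle=\langle X,Q^\dagger Y\rangle$. The symmetric part of the Levi-Civita connection is the symmetric bilinear map $U:\mathfrak{g}\times\mathfrak{g}\to\mathfrak{g}$ determined by $$2\langle U(X,Y),Z\rangle=\langle[Z,X],Y\rangle+\langle[Z,Y],X\rangle\qquad\text{for all }X,Y,Z\in\mathfrak{g};$$ it defines an associative product if $U(U(X,Y),Z)=U(X,U(Y,Z))$ for all $X,Y,Z\in\mathfrak{g}$. Two pseudo-Riemannian Lie algebras are isometrically isomorphic if there is a Lie algebra isomorphism between them that preserves the scalar products. The direct product of pseudo-Riemannian Lie algebras is the direct product Lie algebra with the orthogonal sum of the two scalar products. *)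

(* Defs.v *)
From HB Require Import structures.
From mathcomp Require Import all_boot all_order all_algebra.
From mathcomp Require Import boolp reals ring.

Set Implicit Arguments.
Unset Strict Implicit.
Unset Printing Implicit Defensive.

Import Order.TTheory GRing.Theory Num.Theory.
Local Open Scope ring_scope.

HB.mixin Record Vector_isLieAlgebra (K : fieldType) g of Vector K g := {
  lie : {bilinear g -> g -> g};
  liexx : forall x, lie x x = 0;
  lie_jacobi : forall x y z,
    lie x (lie y z) + lie y (lie z x) + lie z (lie x y) = 0
}.

#[short(type="lieAlgType")]
HB.structure Definition LieAlgebra (K : fieldType) :=
  { g of Vector K g & Vector_isLieAlgebra K g }.

Section LieTheory.
Variables (K : fieldType) (g : lieAlgType K).
Implicit Types (x y : g) (a : {vspace g}).

Definition ad x : 'End(g) := linfun (lie x : g -> g).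

Lemma adE x y : ad x y = lie x y.
Proof. by rewrite lfunE. Qed.

Definition is_abelian := forall x y, lie x y = 0.

Definition abelian_ideal a :=
  (forall x y, y \in a -> lie x y \in a) /\ {in a &, forall x y, lie x y = 0}.

Definition codim_one a := (\dim a).+1 = \dim {:g}.

End LieTheory.

Definition almost_abelian (K : fieldType) (g : lieAlgType K) :=
  ~ is_abelian g /\ exists a : {vspace g}, abelian_ideal a /\ codim_one a.

Section ProdLie.
Variables (K : fieldType) (g h : lieAlgType K).

Definition prod_lie (x y : g * h) : g * h := (lie x.1 y.1, lie x.2 y.2).

Let prod_lie_bilinear : bilinear_for
  (GRing.Scale.Law.clone _ _ *:%R _) (GRing.Scale.Law.clone _ _ *:%R _) prod_lie.
Proof.
by split=> [u|u] c x y; rewrite /prod_lie /= ?linearPl ?linearPr.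
Qed.

HB.instance Definition _ := bilinear_isBilinear.Build K
  (g * h)%type (g * h)%type (g * h)%type _ _ prod_lie prod_lie_bilinear.

Let prod_liexx x : prod_lie x x = 0.
Proof. by rewrite /prod_lie !liexx. Qed.

Let prod_jacobi x y z : prod_lie x (prod_lie y z) + prod_lie y (prod_lie z x)
  + prod_lie z (prod_lie x y) = 0.
Proof.
rewrite /prod_lie /=; congr (_, _); exact: lie_jacobi.
Qed.

HB.instance Definition _ :=
  Vector_isLieAlgebra.Build K (g * h)%type prod_liexx prod_jacobi.
End ProdLie.

Section AbelianLie.
Variables (K : fieldType) (m : nat).

Definition abelian_alg := 'rV[K]_m.
HB.instance Definition _ := Vector.on abelian_alg.

Definition abelian_lie (x y : abelian_alg) : abelian_alg := 0.

Let abelian_bilinear : bilinear_for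
  (GRing.Scale.Law.clone _ _ *:%R _) (GRing.Scale.Law.clone _ _ *:%R _)
  abelian_lie.
Proof. by split=> u c x y; rewrite /abelian_lie /= scaler0 addr0. Qed.

HB.instance Definition _ := bilinear_isBilinear.Build K
  abelian_alg abelian_alg abelian_alg _ _ abelian_lie abelian_bilinear.

Let abelian_liexx x : abelian_lie x x = 0.
Proof. by []. Qed.

Let abelian_jacobi x y z : abelian_lie x (abelian_lie y z)
  + abelian_lie y (abelian_lie z x) + abelian_lie z (abelian_lie x y) = 0.
Proof. by rewrite /abelian_lie !addr0. Qed.

HB.instance Definition _ :=
  Vector_isLieAlgebra.Build K abelian_alg abelian_liexx abelian_jacobi.
End AbelianLie.

(* The basis (E, F, Z) is the canonical basis of K^3, and [E, F] = Z. *)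
Section Heisenberg.
Variable K : fieldType.

Definition heisenberg := 'rV[K]_3.
HB.instance Definition _ := Vector.on heisenberg.

Definition hE : 'I_3 := inord 0.
Definition hF : 'I_3 := inord 1.
Definition hZ : 'I_3 := inord 2.

Definition heisenberg_lie (x y : heisenberg) : heisenberg :=
  (x 0 hE * y 0 hF - x 0 hF * y 0 hE) *: delta_mx 0 hZ.

Let heisenberg_bilinear : bilinear_for
  (GRing.Scale.Law.clone _ _ *:%R _) (GRing.Scale.Law.clone _ _ *:%R _)
  heisenberg_lie.
Proof.
by split=> u c x y; rewrite /heisenberg_lie /= scalerA -scalerDl !mxE;
  congr (_ *: _); ring.
Qed.

HB.instance Definition _ := bilinear_isBilinear.Build K
  heisenberg heisenberg heisenberg _ _ heisenberg_lie heisenberg_bilinear.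

Let heisenberg_liexx x : heisenberg_lie x x = 0.
Proof. by rewrite /heisenberg_lie mulrC subrr scale0r. Qed.

Let heisenberg_central x y z : heisenberg_lie x (heisenberg_lie y z) = 0.
Proof.
rewrite /heisenberg_lie !mxE.
have -> : (hE == hZ) = false by rewrite -val_eqE /= !inordK.
have -> : (hF == hZ) = false by rewrite -val_eqE /= !inordK.
by rewrite andbF !mulr0 subrr scale0r.
Qed.

Let heisenberg_jacobi x y z : heisenberg_lie x (heisenberg_lie y z)
  + heisenberg_lie y (heisenberg_lie z x)
  + heisenberg_lie z (heisenberg_lie x y) = 0.
Proof. by rewrite !heisenberg_central !addr0. Qed.

HB.instance Definition _ := Vector_isLieAlgebra.Build K
  heisenberg heisenberg_liexx heisenberg_jacobi.
End Heisenberg.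

Lemma linfunE (K : fieldType) (V W : vectType K) (f : V -> W) (x : V) :
  linear f -> linfun f x = f x.
Proof.
move=> flin; pose L := GRing.isLinear.Build K V W _ f flin.
pose l : {linear V -> W} := HB.pack f L.
exact: (lfunE l).
Qed.

Record scalar_product (R : realType) (V : vectType R) := ScalarProduct {
  scalar_form :> {symmetric V};
  scalar_nondegenerate : nondegenerate scalar_form
}.

Section ScalarProductTheory.
Variables (R : realType) (V : vectType R) (B : scalar_product V).
Implicit Types (x y z : V) (Q : 'End(V)) (W : {vspace V}).

Definition nondegenerate_on W := (W :&: orthov B W = 0)%VS.

Lemma scalarC x y : B x y = B y x.
Proof. by rewrite hermC expr0 mul1r. Qed.

Lemma scalar_inj x y : (forall z, B x z = B y z) -> x = y.
Proof.
move=> Bxy; apply/eqP; rewrite -subr_eq0 -memv0.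
rewrite -(eqP (scalar_nondegenerate B)); apply/mem_orthovP => z _.
by rewrite linearBl /= Bxy subrr.
Qed.

Definition flat x : 'Hom(V, R^o) := linfun (applyr B x : V -> R^o).

Lemma flatE x z : flat x z = B x z.
Proof. by rewrite lfunE /= scalarC. Qed.

Fact flat_is_linear : linear flat.
Proof.
move=> c x y; apply/lfunP => z.
by rewrite add_lfunE scale_lfunE !flatE linearPl.
Qed.
HB.instance Definition _ :=
  GRing.isLinear.Build R V 'Hom(V, R^o) _ flat flat_is_linear.

(* The Riesz isomorphism V^* -> V. *)
Definition sharp (phi : 'Hom(V, R^o)) : V := ((linfun flat)^-1)%VF phi.

Lemma sharpE phi z : B (sharp phi) z = phi z.
Proof.
have ker0 : lker (linfun flat) == 0%VS.
  apply/lker0P => x y; rewrite !lfunE /= => /lfunP exy.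
  by apply: scalar_inj => t; rewrite -!flatE exy.
rewrite -flatE; have -> : flat (sharp phi) = linfun flat (sharp phi).
  by rewrite lfunE.
rewrite limg_lfunVK //; suff -> : limg (linfun flat) = fullv by rewrite memvf.
apply/eqP; rewrite eqEdim subvf limg_dim_eq; last by rewrite (eqP ker0) capv0.
rewrite !dimvf /=; suff -> : dim 'Hom(V, R^o) = dim V by [].
exact: muln1.
Qed.

Definition adjoint Q : 'End(V) :=
  linfun (fun y => sharp (linfun (fun x => B (Q x) y : R^o))).

Lemma adjointP Q x y : B (Q x) y = B x (adjoint Q y).
Proof.
pose f y' := sharp (linfun (fun x' => B (Q x') y' : R^o)).
have fE y' z : B (f y') z = B (Q z) y'.
  by rewrite sharpE linfunE // => c u v; rewrite linearP linearPl.
have flin : linear f.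
  move=> c u v; apply: scalar_inj => z.
  by rewrite linearPl /= !fE linearPr.
by rewrite -[adjoint Q]/(linfun f) linfunE // [RHS]scalarC fE.
Qed.

Definition sym_part Q : 'End(V) := 2^-1 *: (Q + adjoint Q).

(* The signature is (p, q), with p and q the largest dimensions of subspaces on
   which B is positive definite, resp. negative definite. *)
Definition inertia (c : R) : nat :=
  \max_(d < (\dim {:V}).+1 | `[< exists W : {vspace V}, \dim W = d /\
      {in W, forall x, x != 0 -> 0 < c * B x x} >]) d.

Definition signature : nat * nat := (inertia 1, inertia (-1)).

End ScalarProductTheory.

Section OrthogonalSum.
Variables (R : realType) (V1 V2 : vectType R).
Variables (B1 : scalar_product V1) (B2 : scalar_product V2).

Definition orthosum_form (x y : V1 * V2) : R := B1 x.1 y.1 + B2 x.2 y.2.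

Let orthosum_bilinear : bilinear_for
  (GRing.Scale.Law.clone _ _ *%R _) (GRing.Scale.Law.clone _ _ (idfun \; *%R) _)
  orthosum_form.
Proof.
split=> u c x y; rewrite /orthosum_form /= ?linearPl ?linearPr /=;
  by rewrite mulrDr addrACA.
Qed.

HB.instance Definition _ := bilinear_isBilinear.Build R
  (V1 * V2)%type (V1 * V2)%type R _ _ orthosum_form orthosum_bilinear.

Let orthosum_sym x y :
  orthosum_form x y = (-1) ^+ false * idfun (orthosum_form y x).
Proof. by rewrite mul1r /orthosum_form scalarC [B2 _ _]scalarC. Qed.

HB.instance Definition _ := isHermitianSesquilinear.Build R
  (V1 * V2)%type false idfun orthosum_form orthosum_sym.

Let orthosum_nondegenerate : nondegenerate (orthosum_form : {symmetric _}).
Proof.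
rewrite /nondegenerate -subv0; apply/subvP => -[x y] /mem_orthovP o.
have -> : x = 0.
  apply: (@scalar_inj _ _ B1) => z; rewrite linear0l.
  have := o (z, 0) (memvf _); rewrite /= /orthosum_form /=.
  by rewrite linear0r addr0.
have -> : y = 0; last exact: mem0v.
apply: (@scalar_inj _ _ B2) => z; rewrite linear0l.
have := o (0, z) (memvf _); rewrite /= /orthosum_form /=.
by rewrite linear0r add0r.
Qed.

Definition orthosum : scalar_product (V1 * V2)%type :=
  ScalarProduct orthosum_nondegenerate.

End OrthogonalSum.

(* <E, E> = (-1)^s, <F, Z> = 1, and the other products vanish. *)
Section HeisenbergMetric.
Variables (R : realType) (s : bool).

Definition heisenberg_form (x y : heisenberg R) : R :=
  (-1) ^+ s * (x 0 hE * y 0 hE) + (x 0 hF * y 0 hZ + x 0 hZ * y 0 hF).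

Let heisenberg_form_bilinear : bilinear_for
  (GRing.Scale.Law.clone _ _ *%R _) (GRing.Scale.Law.clone _ _ (idfun \; *%R) _)
  heisenberg_form.
Proof.
by split=> u c x y; rewrite /heisenberg_form /= !mxE; ring.
Qed.

HB.instance Definition _ := bilinear_isBilinear.Build R
  (heisenberg R) (heisenberg R) R _ _ heisenberg_form heisenberg_form_bilinear.

Let heisenberg_form_sym x y :
  heisenberg_form x y = (-1) ^+ false * idfun (heisenberg_form y x).
Proof.
rewrite mul1r /heisenberg_form /= [y 0 hE * _]mulrC; congr (_ + _).
by rewrite addrC [y 0 hF * _]mulrC [y 0 hZ * _]mulrC.
Qed.

HB.instance Definition _ := isHermitianSesquilinear.Build R
  (heisenberg R) false idfun heisenberg_form heisenberg_form_sym.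

Let heisenberg_form_nondegenerate :
  nondegenerate (heisenberg_form : {symmetric _}).
Proof.
rewrite /nondegenerate -subv0; apply/subvP => x /mem_orthovP o.
have EF : (hE == hF) = false by rewrite -val_eqE /= !inordK.
have EZ : (hE == hZ) = false by rewrite -val_eqE /= !inordK.
have FZ : (hF == hZ) = false by rewrite -val_eqE /= !inordK.
have := o (delta_mx 0 hE) (memvf _); have := o (delta_mx 0 hF) (memvf _).
have := o (delta_mx 0 hZ) (memvf _); rewrite /= /heisenberg_form !mxE !eqxx.
rewrite ![_ == hE]eq_sym ![hZ == hF]eq_sym EF EZ FZ /=.
rewrite !(mulr0, mulr1, addr0, add0r) => xF xZ /eqP.
rewrite mulf_eq0 signr_eq0 /= => /eqP xE.
rewrite memv0; apply/eqP/rowP => i; rewrite mxE.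
have : i \in [:: hE; hF; hZ].
  by rewrite !inE -!val_eqE /= !inordK //; case: i => [[|[|[|]]]].
by rewrite !inE => /or3P[] /eqP->.
Qed.

Definition heisenberg_metric : scalar_product (heisenberg R) :=
  ScalarProduct heisenberg_form_nondegenerate.

End HeisenbergMetric.

Section PseudoRiemannianLie.
Variables (R : realType) (g : lieAlgType R) (B : scalar_product g).
Implicit Types x y z : g.

(* The symmetric part U of the Levi-Civita connection, characterized by
   [LC_symP]. *)
Definition LC_sym x y : g :=
  sharp B (linfun (fun z => 2^-1 * (B (lie z x) y + B (lie z y) x) : R^o)).

Lemma LC_symP x y z : 2 * B (LC_sym x y) z = B (lie z x) y + B (lie z y) x.
Proof.
pose f z' : R^o := 2^-1 * (B (lie z' x) y + B (lie z' y) x).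
have flin : linear f.
  move=> c u v; rewrite /f !linearPl /= -[c *: _]/(c * _) mulrCA -mulrDr.
  by congr (_ * _); rewrite mulrDr addrACA.
rewrite /LC_sym sharpE -[linfun _]/(linfun f) linfunE // /f.
by rewrite mulVKf // pnatr_eq0.
Qed.

End PseudoRiemannianLie.

Definition isometrically_isomorphic (R : realType) (g h : lieAlgType R)
    (B : scalar_product g) (C : scalar_product h) :=
  exists f : 'Hom(g, h),
    [/\ bijective f, {morph f : x y / lie x y} & isometry C B f].

(* Main.v *)
(* Write D for ad_e, D' for its adjoint and eps = <e,e>; then
   [x, y] = eps (<x,e> D y - <y,e> D x), so that
     2 U(x, y) = eps (q(x, y) e - <x,e> D' y - <y,e> D' x),
   with q(x, y) = <D x, y> + <D y, x>, which is non-zero by assumption.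
   Associativity on (e, e, y) gives D'^2 = 0, and associativity on the
   orthogonal of e gives q(x, y) D' z = q(y, z) D' x.  The latter forces D to
   be self-adjoint of rank one, D z = +-<w, z> w, and then D'^2 = 0 makes w
   null.  With E = +-e, Z = w and F a null vector dual to w and orthogonal to e,
   the orthogonal of (E, F, Z) is the abelian factor.  Conversely, in the
   product the values of U have no F-component, and (xy)z is a symmetric expression. *)
Require Import Defs.
From HB Require Import structures.
From mathcomp Require Import all_boot all_order all_algebra.
From mathcomp Require Import boolp reals ring.

Set Implicit Arguments.
Unset Strict Implicit.
Unset Printing Implicit Defensive.

Import Order.TTheory GRing.Theory Num.Theory.
Local Open Scope ring_scope.

(** * Computation rules for scalar products, adjoints and symmetric parts *)

Section ScalarProductArithmetic.
Variables (R : realType) (V : vectType R) (B : scalar_product V).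
Implicit Types x y z : V.

Lemma scalarDl x y z : B (x + y) z = B x z + B y z.
Proof. exact: linearDl. Qed.
Lemma scalarDr x y z : B z (x + y) = B z x + B z y.
Proof. exact: linearDr. Qed.
Lemma scalarNl x z : B (- x) z = - B x z.
Proof. exact: linearNl. Qed.
Lemma scalarNr x z : B z (- x) = - B z x.
Proof. exact: linearNr. Qed.
Lemma scalarZl c x z : B (c *: x) z = c * B x z.
Proof. exact: linearZl_LR. Qed.
Lemma scalarZr c x z : B z (c *: x) = c * B z x.
Proof. exact: linearZr_LR. Qed.
Lemma scalar0l z : B 0 z = 0. Proof. exact: linear0l. Qed.
Lemma scalar0r z : B z 0 = 0. Proof. exact: linear0r. Qed.

Definition scalarE := (scalarDl, scalarDr, scalarNl, scalarNr, scalarZl,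
  scalarZr, scalar0l, scalar0r).

Lemma adjointPr (Q : 'End(V)) x y : B (adjoint B Q x) y = B x (Q y).
Proof. by rewrite scalarC -adjointP scalarC. Qed.

Lemma sym_partP (Q : 'End(V)) x y :
  2 * B (sym_part B Q x) y = B (Q x) y + B (Q y) x.
Proof.
rewrite /sym_part scale_lfunE add_lfunE !scalarE adjointPr [B x _]scalarC.
by rewrite mulVKf // pnatr_eq0.
Qed.

End ScalarProductArithmetic.

(** * Scalar products induced along a linear map *)

Section Pullback.
Variables (R : realType) (V W : vectType R) (B : scalar_product W).
Variable j : 'Hom(V, W).

Definition pullback_form (x y : V) : R := B (j x) (j y).

Let pullback_bilinear : bilinear_for
  (GRing.Scale.Law.clone _ _ *%R _) (GRing.Scale.Law.clone _ _ (idfun \; *%R) _)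
  pullback_form.
Proof. by split=> u c x y; rewrite /pullback_form linearP !scalarE. Qed.

HB.instance Definition _ := bilinear_isBilinear.Build R
  V V R _ _ pullback_form pullback_bilinear.

Let pullback_sym x y :
  pullback_form x y = (-1) ^+ false * idfun (pullback_form y x).
Proof. by rewrite mul1r /pullback_form scalarC. Qed.

HB.instance Definition _ := isHermitianSesquilinear.Build R
  V false idfun pullback_form pullback_sym.

Hypothesis j_nondegenerate :
  forall x, (forall y, B (j x) (j y) = 0) -> x = 0.

Let pullback_nondegenerate : nondegenerate (pullback_form : {symmetric _}).
Proof.
rewrite /nondegenerate -subv0; apply/subvP => x /mem_orthovP o.
by rewrite memv0; apply/eqP/j_nondegenerate => y; apply: o (memvf _).
Qed.

Definition pullback : scalar_product V := ScalarProduct pullback_nondegenerate.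

End Pullback.

(** * Invariance of the signature under isometric isomorphisms *)

Section SignatureInvariance.
Variables (R : realType).

Lemma definite_subspace_image (V W : vectType R) (B : scalar_product V)
    (C : scalar_product W) (f : 'Hom(V, W)) (c : R) (d : nat) :
    injective f -> isometry C B f ->
  (exists U : {vspace V}, \dim U = d /\
    {in U, forall x, x != 0 -> 0 < c * B x x}) ->
  (exists U : {vspace W}, \dim U = d /\
    {in U, forall x, x != 0 -> 0 < c * C x x}).
Proof.
move=> f_inj f_iso [U [dimU posU]]; exists (f @: U)%VS; split.
  have kf : lker f == 0%VS by apply/lker0P.
  by rewrite limg_dim_eq // (eqP kf) capv0.
move=> _ /memv_imgP[x xU ->] fx0; rewrite f_iso; apply: posU => //.
by apply: contraNneq fx0 => ->; rewrite linear0.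
Qed.

(** The maxima defining [inertia] run over the same dimensions, because the isomorphism and its
    inverse both carry definite subspaces to definite subspaces. *)
Lemma isometric_signature (g h : lieAlgType R) (B : scalar_product g)
    (C : scalar_product h) :
  isometrically_isomorphic B C -> signature C = signature B.
Proof.
move=> [f [f_bij _ f_iso]]; have f_inj := bij_inj f_bij.
have kf : lker f == 0%VS by apply/lker0P.
have ff : limg f = fullv.
  apply/eqP; rewrite eqEsubv subvf; apply/subvP => y _.
  by case: f_bij => k _ kK; rewrite -[y]kK memv_img ?memvf.
have dimE : \dim {:g} = \dim {:h}.
  by rewrite -ff limg_dim_eq // (eqP kf) capv0.
have fVK : cancel (f^-1)%VF f by move=> y; rewrite limg_lfunVK ?ff ?memvf.
suff E c : inertia C c = inertia B c by rewrite /signature !E.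
rewrite /inertia dimE; apply: eq_bigl => d; apply/asboolP/asboolP.
  have fV_iso : isometry B C (f^-1)%VF by move=> x y; rewrite -f_iso !fVK.
  exact: (definite_subspace_image (can_inj fVK) fV_iso).
exact: (definite_subspace_image f_inj f_iso).
Qed.

End SignatureInvariance.

Lemma hE_F : (hE == hF) = false. Proof. by rewrite -val_eqE /= !inordK. Qed.
Lemma hE_Z : (hE == hZ) = false. Proof. by rewrite -val_eqE /= !inordK. Qed.
Lemma hF_Z : (hF == hZ) = false. Proof. by rewrite -val_eqE /= !inordK. Qed.

(** * Associativity on the Heisenberg products, and its transport *)

Section HeisenbergProduct.
Variables (R : realType).

(** [LC_symP] determines U from the bracket and the scalar product, and surjectivity of [f] lets
    every test vector be taken as an image. *)
Lemma LC_sym_isometry (g h : lieAlgType R) (B : scalar_product g)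
    (C : scalar_product h) (f : 'Hom(g, h)) :
    bijective f -> {morph f : x y / lie x y} -> isometry C B f ->
  {morph f : x y / LC_sym B x y >-> LC_sym C x y}.
Proof.
move=> [k fK kK] f_lie f_iso x y; apply: (@scalar_inj _ _ C) => z.
apply: (@mulfI _ 2); first by rewrite pnatr_eq0.
by rewrite -[z]kK LC_symP f_iso LC_symP -!f_lie !f_iso.
Qed.

Lemma LC_sym_associative_isometry (g h : lieAlgType R) (B : scalar_product g)
    (C : scalar_product h) :
  isometrically_isomorphic B C -> associative (LC_sym C) ->
  associative (LC_sym B).
Proof.
move=> [f [f_bij f_lie f_iso]] assocC x y z; apply: (bij_inj f_bij).
by rewrite !(LC_sym_isometry f_bij f_lie f_iso) assocC.
Qed.

Variables (m : nat) (s : bool) (C : scalar_product (abelian_alg R m)).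
Let B := orthosum (heisenberg_metric R s) C.
Let hx := (heisenberg R * abelian_alg R m)%type.

Lemma heisenberg_LC_sym (x y : hx) :
  LC_sym B x y =
  (((-1) ^+ s * (x.1 0 hF * y.1 0 hF)) *: (delta_mx 0 hE : 'rV_3)
     - (2^-1 * (x.1 0 hE * y.1 0 hF + y.1 0 hE * x.1 0 hF))
         *: (delta_mx 0 hZ : 'rV_3), 0).
Proof.
apply: (@scalar_inj _ _ B) => z.
apply: (@mulfI _ 2); first by rewrite pnatr_eq0.
rewrite LC_symP /= /orthosum_form /= /heisenberg_form /= /heisenberg_lie.
rewrite /abelian_lie !mxE !scalar0l ?[hF == hE]eq_sym ?[hZ == hE]eq_sym.
rewrite ?[hZ == hF]eq_sym.
rewrite hE_F hE_Z hF_Z !eqxx /=; case: (s); rewrite /= ?expr0 ?expr1; by field.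
Qed.

(** Only the E-coordinate of the inner product survives, so either bracketing equals -1/2 (-1)^s x_F
    y_F z_F Z. *)
Lemma heisenberg_LC_sym_associative : associative (LC_sym B).
Proof.
move=> x y z; rewrite !heisenberg_LC_sym /= !mxE ?[hF == hE]eq_sym.
rewrite ?[hZ == hE]eq_sym ?[hZ == hF]eq_sym hE_F hE_Z hF_Z !eqxx /=.
congr (_ *: _ - _ *: _, _); ring.
Qed.

End HeisenbergProduct.

(** * Linear algebra of the identity q(x, y) D' z = q(y, z) D' x *)

Section RankOneDerivation.
Variables (R : realType) (V : vectType R) (B : scalar_product V).
Variable D : 'End(V).
Let q x y := B (D x) y + B (D y) x.

Hypothesis D_sym : sym_part B D <> 0.
Hypothesis qD : forall x y z,
  q x y *: adjoint B D z = q y z *: adjoint B D x.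

(** Fixing q(x0, y0) = k non-zero in [qD] gives D' rank one, hence D z = (<v, z> / k) r.
    Substituting back makes q a multiple of r ⊗ r; as q is also the symmetrisation of v ⊗ r / k, [v]
    is proportional to [r]. *)
Lemma rank_one_adjoint :
  exists c p, [/\ c != 0, p != 0 & forall z, D z = (c * B p z) *: p].
Proof.
have [x0 [y0 k0]] : exists x y, q x y != 0.
  apply: contrapT => nq; apply: D_sym; apply/lfunP => x.
  apply: (@scalar_inj _ _ B) => y; apply: (@mulfI _ 2); first by rewrite pnatr_eq0.
  rewrite sym_partP lfunE /= scalar0l mulr0; apply: contrapT => /eqP qxy.
  by apply: nq; exists x, y.
have qC x y : q x y = q y x by rewrite /q addrC.
(* [r] represents the functional q(y0, .) and will span the image of D; [v] will span that of D'. *)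
pose r := 2 *: sym_part B D y0; pose v := adjoint B D x0.
set k := q x0 y0 in k0.
have rE z : B r z = q y0 z by rewrite scalarZl sym_partP.
have DE z : adjoint B D z = (B r z / k) *: v.
  by rewrite mulrC -scalerA rE -qD scalerA mulVf // scale1r.
have v0 : v != 0.
  apply: contraNneq k0 => v0.
  by rewrite /k /q !adjointP !DE v0 !scaler0 !scalar0r addr0.
have D'E z : D z = (B v z / k) *: r.
  apply: (@scalar_inj _ _ B) => y; rewrite adjointP DE !scalarE [B z v]scalarC.
  ring.
have qE x y : q x y = B v x / k * B r y + B v y / k * B r x.
  by rewrite /q !D'E !scalarZl.
have rx0 : B r x0 = k by rewrite rE qC.
have qr x y z : q x y * B r z = q y z * B r x.
  apply/eqP; rewrite -subr_eq0 -(mulIr_eq0 _ (mulIf (invr_neq0 k0))).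
  have := qD x y z; rewrite !DE !scalerA => /eqP; rewrite -subr_eq0 -scalerBl.
  by rewrite scaler_eq0 (negPf v0) orbF mulrBl !mulrA.
have q_r x y : q x y * k * k = q x0 x0 * B r x * B r y.
  have := qr x y x0; have := qr y x0 x0; rewrite rx0 [q y x0]qC => e1 ->.
  by rewrite mulrAC e1; ring.
(* By [qE], q(z, x0) = <v, z> + (<v, x0> / k) <r, z>; by [q_r] it is (q(x0, x0) / k) <r, z>. Solving
   for <v, z> gives [mu]. *)
pose mu := q x0 x0 / k - B v x0 / k.
have vE : v = mu *: r.
  apply: (@scalar_inj _ _ B) => z; rewrite scalarZl.
  have := q_r z x0; rewrite qE rx0 => /(mulIf k0) e1.
  by rewrite /mu mulrBl mulrAC -e1; field.
exists (mu / k), r; split.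
- apply: contraNneq v0 => /eqP; rewrite mulf_eq0 invr_eq0 (negPf k0) orbF.
  by move/eqP => mu0; rewrite vE mu0 scale0r.
- by apply: contraNneq k0 => r0; rewrite -rx0 r0 scalar0l.
- by move=> z; rewrite D'E vE scalarZl mulrAC.
Qed.

End RankOneDerivation.

(** Scaling [p] by the square root of |c| absorbs [c] up to its sign. *)
Lemma rank_one_normalize (R : realType) (V : vectType R) (B : scalar_product V)
    (D : 'End(V)) (c : R) (p : V) :
    c != 0 -> p != 0 -> (forall z, D z = (c * B p z) *: p) ->
  exists (s : bool) (w : V), w != 0 /\ forall z, D z = ((-1) ^+ s * B w z) *: w.
Proof.
move=> c0 p0 DE; exists (c < 0), (Num.sqrt `|c| *: p); split.
  by rewrite scaler_eq0 negb_or p0 sqrtr_eq0 -ltNge normr_gt0 c0.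
move=> z; rewrite DE scalarZl scalerA; congr (_ *: _).
rewrite {1}[c]realEsign ?num_real // -{1}(sqr_sqrtr (normr_ge0 c)); ring.
Qed.

(** * Recognition of the Heisenberg product from a frame E, F, w *)

Section HeisenbergRecognition.
Variables (R : realType) (g : lieAlgType R) (B : scalar_product g).
Variables (s : bool) (E w F : g).
Hypotheses (BEE : B E E = (-1) ^+ s) (BEw : B E w = 0) (BEF : B E F = 0).
Hypotheses (Bww : B w w = 0) (BFF : B F F = 0) (BFw : B F w = 1).
Hypothesis lieE : forall x y,
  lie x y = ((-1) ^+ s * (B x E * B y w - B y E * B x w)) *: w.

Let W : {vspace g} := orthov B <<[:: E; F; w]>>.
Let m := \dim W.

Let W_spec x : x \in W -> [/\ B x E = 0, B x F = 0 & B x w = 0].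
Proof.
move=> /mem_orthovP xW.
by split; apply: xW; rewrite memv_span // !inE eqxx ?orbT.
Qed.

Let W_mem x : B x E = 0 -> B x F = 0 -> B x w = 0 -> x \in W.
Proof.
move=> xE xF xw; apply/mem_orthovP => y.
move=> /(@coord_span _ _ _ [tuple E; F; w]) yE; rewrite {1}yE.
rewrite linear_sumr big1 // => i _; rewrite /= scalarZr /=.
by case: i => [[|[|[|]]]] //= ?; rewrite ?xE ?xF ?xw mulr0.
Qed.

(** The abelian factor consists of row vectors, so [W] is parametrised by coordinates in a basis. *)
Let j (u : abelian_alg R m) : g := \sum_i u 0 i *: (vbasis W)`_i.

Let j_linear : linear j.
Proof.
move=> c u v; rewrite /j scaler_sumr -big_split /=; apply: eq_bigr => i _.
by rewrite !mxE scalerDl scalerA.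
Qed.

Let jW u : j u \in W.
Proof.
by apply: rpred_sum => i _; rewrite rpredZ // vbasis_mem // mem_nth // size_tuple.
Qed.

Let j_onto x : x \in W -> exists u, x = j u.
Proof.
move=> /coord_vbasis xE; exists (\row_i coord (vbasis W) i x).
by rewrite {1}xE; apply: eq_bigr => i _; rewrite mxE.
Qed.

(** Orthogonal projection onto [W]. As F, w is a hyperbolic pair, the F-coefficient of x is <x, w>
    and the w-coefficient is <x, F>. *)
Let res (x : g) : g :=
  x - ((-1) ^+ s * B x E) *: E - B x w *: F - B x F *: w.

Let resW x : res x \in W.
Proof.
have BwE : B w E = 0 by rewrite scalarC.
have BFE : B F E = 0 by rewrite scalarC.
have BwF : B w F = 1 by rewrite scalarC.
have ss : (-1) ^+ s * (-1) ^+ s = 1 :> R by rewrite -expr2 sqrr_sign.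
apply: W_mem; rewrite /res !scalarE ?BEE ?BEw ?BEF ?Bww ?BFF ?BFw ?BwE ?BFE ?BwF.
- by rewrite mulrAC ss; ring.
- ring.
- ring.
Qed.

Let jl := linfun j.

(** Each x differs from [res x] by a combination of E, F and w, all orthogonal to [W]; so a vector
    of [W] orthogonal to [W] is orthogonal to everything. *)
Let jl_nondegenerate u : (forall v, B (jl u) (jl v) = 0) -> u = 0.
Proof.
have jlE v : jl v = j v by rewrite linfunE.
move=> ju; have j0 : j u = 0.
  apply: (@scalar_inj _ _ B) => x; rewrite scalar0l.
  have [v rv] := j_onto (resW x); have := ju v; rewrite !jlE -rv /res.
  have [uE uF uw] := W_spec (jW u).
  by rewrite !scalarE uE uF uw !mulr0 !oppr0 !addr0.
apply/rowP => i; rewrite mxE.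
have := coord_sum_free (u 0) i (basis_free (vbasisP W)).
by rewrite -/(j u) j0 linear0 => <-.
Qed.

Let C := pullback jl_nondegenerate.
Let h : lieAlgType R := (heisenberg R * abelian_alg R m)%type.

Let phi (x : h) : g :=
  x.1 0 hE *: E + x.1 0 hF *: F + x.1 0 hZ *: w + j x.2.

Let phi_linear : linear phi.
Proof.
move=> c x y; apply: (@scalar_inj _ _ B) => z.
by rewrite /phi j_linear !scalarE !mxE; ring.
Qed.

Let phi_isometry x y :
  B (phi x) (phi y) = orthosum (heisenberg_metric R s) C x y.
Proof.
have [xE xF xw] := W_spec (jW x.2); have [yE yF yw] := W_spec (jW y.2).
rewrite /= /orthosum_form /= /heisenberg_form /pullback_form /jl !linfunE //.
rewrite !scalarE xE xF xw !(scalarC B _ (j y.2)) yE yF yw.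
rewrite (scalarC B F E) (scalarC B w E) (scalarC B w F).
by rewrite BEE BEF BEw BFF BFw Bww; ring.
Qed.

Let phi_E x : B (phi x) E = (-1) ^+ s * x.1 0 hE.
Proof.
have [xE _ _] := W_spec (jW x.2).
by rewrite /phi !scalarE xE BEE (scalarC B F) BEF (scalarC B w) BEw; ring.
Qed.

Let phi_w x : B (phi x) w = x.1 0 hF.
Proof.
have [_ _ xw] := W_spec (jW x.2).
by rewrite /phi !scalarE xw BEw BFw Bww; ring.
Qed.

(** [lieE] sees only the E- and F-coordinates, and its sign cancels <E, E>, so that [E, F] = w. *)
Let phi_lie x y : phi (lie x y) = lie (phi x) (phi y).
Proof.
rewrite lieE !phi_E !phi_w /phi /= /heisenberg_lie /abelian_lie !mxE.
have -> : j 0 = 0 by rewrite /j big1 // => i _; rewrite mxE scale0r.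
rewrite hE_Z hF_Z !eqxx /= !mulr0 mulr1 !scale0r !add0r addr0.
by congr (_ *: _); case: (s); rewrite /= ?expr0 ?expr1; ring.
Qed.

Let phil := linfun phi.
Let philE x : phil x = phi x. Proof. exact: linfunE. Qed.

Let phil_ker : lker phil == 0%VS.
Proof.
apply/lker0P => x y; rewrite !philE => xy.
apply: (@scalar_inj _ _ (orthosum (heisenberg_metric R s) C)) => z.
by rewrite -!phi_isometry xy.
Qed.

Let phil_full : limg phil = fullv.
Proof.
apply/eqP; rewrite eqEsubv subvf; apply/subvP => x _.
have [u ru] := j_onto (resW x).
pose v : heisenberg R :=
  \row_i [:: (-1) ^+ s * B x E; B x w; B x F]`_i.
have -> : x = phil (v, u).
  rewrite philE /phi -ru !mxE !inordK //= /res; apply/eqP; rewrite -subr_eq0.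
  apply/eqP; apply: (@scalar_inj _ _ B) => z; rewrite !scalarE; ring.
by rewrite memv_img ?memvf.
Qed.

Lemma heisenberg_recognition n : \dim {:g} = n ->
  (3 <= n)%N /\ exists C0 : scalar_product (abelian_alg R (n - 3)),
    isometrically_isomorphic B (orthosum (heisenberg_metric R s) C0).
Proof.
have -> : \dim {:g} = (3 + m)%N.
  rewrite -phil_full limg_dim_eq ?(eqP phil_ker) ?capv0 //.
  by rewrite !dimvf /dim /=; congr (_ + _)%N; apply: mul1n.
(* Here n = 3 + m, so [n - 3] becomes [m] and [C] has the required type. *)
move=> <-; split=> //; rewrite addKn; exists C, (phil^-1)%VF.
have KV : cancel (phil^-1)%VF phil by move=> x; rewrite limg_lfunVK // phil_full memvf.
have K := lker0_lfunK phil_ker.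
split; first by exists phil.
- by move=> x y; apply: (can_inj K); rewrite KV philE phi_lie -!philE !KV.
- by move=> x y; rewrite -phi_isometry -!philE !KV.
Qed.

End HeisenbergRecognition.

Lemma lieC (K : fieldType) (g : lieAlgType K) (x y : g) : lie x y = - lie y x.
Proof.
apply/eqP; rewrite -addr_eq0; have := liexx (x + y).
by rewrite linearDl !linearDr /= !liexx add0r addr0 => ->.
Qed.

(** * Consequences of associativity when ad e determines the bracket *)

Section AlmostAbelian.
Variables (R : realType) (g : lieAlgType R) (B : scalar_product g) (e : g).
Let D := ad e.
Let Dt := adjoint B D.
Let eps := B e e.
Let q x y := B (D x) y + B (D y) x.

Hypothesis eps2 : eps * eps = 1.
Hypothesis Be : forall x, B (D x) e = 0.
Hypothesis lieE : forall x y, lie x y = eps *: (B x e *: D y - B y e *: D x).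

Let De : D e = 0. Proof. by rewrite /D adE liexx. Qed.

Let Dte : Dt e = 0.
Proof.
apply: (@scalar_inj _ _ B) => z.
by rewrite adjointPr scalarC Be scalar0l.
Qed.

Lemma LC_symE x y :
  LC_sym B x y =
  (2^-1 * eps) *: (q x y *: e - B x e *: Dt y - B y e *: Dt x).
Proof.
apply: (@scalar_inj _ _ B) => z; apply: (@mulfI _ 2); first by rewrite pnatr_eq0.
rewrite LC_symP !lieE !scalarE !adjointPr (scalarC B y (D z)) (scalarC B x (D z)).
rewrite (scalarC B e z) /q; by field.
Qed.

Lemma LC_symC x y : LC_sym B x y = LC_sym B y x.
Proof.
by rewrite !LC_symE /q [B (D x) y + _]addrC addrAC.
Qed.

Lemma LC_symZl c x y : LC_sym B (c *: x) y = c *: LC_sym B x y.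
Proof.
apply: (@scalar_inj _ _ B) => z; apply: (@mulfI _ 2); first by rewrite pnatr_eq0.
rewrite scalarZl mulrCA !LC_symP linearZr_LR /= !scalarE; ring.
Qed.

Lemma LC_sym_e y : LC_sym B e y = - 2^-1 *: Dt y.
Proof.
rewrite LC_symE /q De scalar0l Be addr0 scale0r sub0r Dte scaler0 subr0.
by rewrite -/eps -scalerN scalerA -mulrA eps2 mulr1 scalerN scaleNr.
Qed.

Hypothesis assocU : associative (LC_sym B).

Lemma adjoint_ad_square y : Dt (Dt y) = 0.
Proof.
(* U(e, e) = 0 because D' e = 0; writing [0] as [0 *: 0] lets homogeneity give U(0, y) = 0. *)
have := assocU e e y; rewrite !LC_sym_e Dte scaler0 -(scale0r 0) LC_symZl !scale0r.
rewrite linearZ /= scalerA => /eqP; rewrite scaler_eq0 mulf_eq0 oppr_eq0 invr_eq0.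
by rewrite pnatr_eq0 /= => /eqP.
Qed.

(** D, D' and q are unchanged by the projection P onto the orthogonal of e, where U takes values in
    the line of e. Hence the identity holds for all vectors, not only those orthogonal to e. *)
Lemma associative_rank_one x y z : q x y *: Dt z = q y z *: Dt x.
Proof.
pose P x := x - (eps * B x e) *: e.
have Pe u : B (P u) e = 0 by rewrite /P !scalarE -/eps mulrAC eps2 mul1r subrr.
have DP u : D (P u) = D u by rewrite /P linearB linearZ /= De scaler0 subr0.
have DtP u : Dt (P u) = Dt u by rewrite /P linearB linearZ /= Dte scaler0 subr0.
have qP u v : q (P u) (P v) = q u v.
  by rewrite /q !DP /P !scalarE !Be !mulr0 oppr0 !addr0.
have UP u v : LC_sym B (P u) (P v) = (2^-1 * eps * q u v) *: e.
  by rewrite LC_symE qP !Pe !scale0r !subr0 scalerA.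
have := assocU (P x) (P y) (P z); rewrite LC_symC !UP !LC_symZl !LC_sym_e !DtP.
have c0 : 2^-1 * eps * - 2^-1 != 0.
  rewrite !mulf_eq0 oppr_eq0 invr_eq0 pnatr_eq0 /= orbF.
  by apply/eqP => e0; move/eqP: eps2; rewrite e0 mul0r eq_sym oner_eq0.
rewrite !scalerA ![_ * q _ _ * _]mulrAC -!scalerA => E.
by apply/esym/(scalerI c0); rewrite -!scalerA.
Qed.

Lemma associative_heisenberg n :
    sym_part B (ad e) <> 0 -> \dim {:g} = n ->
  (3 <= n)%N /\ exists (s : bool) (C : scalar_product (abelian_alg R (n - 3))),
    isometrically_isomorphic B (orthosum (heisenberg_metric R s) C).
Proof.
move=> D_sym dim_g.
have [c [p [c0 p0 DE0]]] := rank_one_adjoint D_sym associative_rank_one.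
have [s [w [w0 DE]]] := rank_one_normalize c0 p0 DE0.
have sc (t : R) : ((-1) ^+ s * t == 0) = (t == 0).
  by rewrite mulf_eq0 signr_eq0.
have Bwe : B w e = 0.
  by have /eqP := DE e; rewrite -/D De eq_sym scaler_eq0 (negPf w0) orbF sc => /eqP.
have [y Bwy] : exists y, B w y != 0.
  apply: contrapT => nw; move/eqP: w0; apply; apply: (@scalar_inj _ _ B) => y.
  by rewrite scalar0l; apply: contrapT => /eqP wy; apply: nw; exists y.
have Bww : B w w = 0.
  (* D^2 is adjoint to D'^2 = 0, while D^2 y = <w, y> <w, w> w. *)
  have DDy : D (D y) = 0.
    apply: (@scalar_inj _ _ B) => z.
    by rewrite scalar0l !adjointP -/D -/Dt adjoint_ad_square scalar0r.
  have /eqP := DDy; rewrite /D DE scaler_eq0 (negPf w0) orbF sc DE scalarZr.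
  by rewrite mulf_eq0 sc (negPf Bwy) => /eqP.
have [t epsE] : exists t : bool, eps = (-1) ^+ t.
  have /eqP := eps2; rewrite -expr2 sqrf_eq1 => /orP[]/eqP->; last by exists true.
  by exists false.
have [F1 [BF1e BF1w]] : exists F1, B F1 e = 0 /\ B F1 w = 1.
  (* Remove the e-component of [y], then rescale; <w, e> = 0 keeps the pairing with [w]. *)
  exists ((B w y)^-1 *: (y - (eps * B y e) *: e)); split.
    by rewrite !scalarE -/eps mulrAC eps2 mul1r subrr mulr0.
  by rewrite !scalarE (scalarC B y) (scalarC B e) Bwe mulr0 oppr0 addr0 mulVf.
(* Since [w] is null and <F1, w> = 1, this correction makes F null and keeps <F, w> = 1. *)
pose F := F1 - (2^-1 * B F1 F1) *: w.
have [n3 [C iso]] : (3 <= n)%N /\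
    exists C : scalar_product (abelian_alg R (n - 3)),
    isometrically_isomorphic B (orthosum (heisenberg_metric R t) C).
  (* D F = (-1)^s w, so this sign on [e] yields [E, F] = w; <E, E> is still [eps], whose sign [t] is
     unrelated to [s]. *)
  apply: (@heisenberg_recognition _ _ _ _ ((-1) ^+ s *: e) w F) dim_g.
  - by rewrite !scalarE mulrA -expr2 sqrr_sign mul1r.
  - by rewrite scalarZl scalarC Bwe mulr0.
  - by rewrite /F !scalarE !(scalarC B e) BF1e Bwe !mulr0 subrr.
  - by [].
  - by rewrite /F !scalarE (scalarC B w) BF1w Bww; field.
  - by rewrite /F !scalarE BF1w Bww mulr0 subr0.
  move=> u v; rewrite lieE /D !DE !scalarE !scalerA -scalerBl scalerA -epsE.
  by congr (_ *: _); rewrite !(scalarC B w); ring.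
by split=> //; exists t, C.
Qed.

End AlmostAbelian.

(** * The bracket in terms of the unit normal of the abelian ideal *)

Section NondegenerateIdeal.
Variables (R : realType) (g : lieAlgType R) (B : scalar_product g).
Variables (a : {vspace g}) (e : g).
Hypotheses (a_ideal : abelian_ideal a) (a_codim : codim_one a).
Hypotheses (e_orth : e \in orthov B a) (eps2 : B e e * B e e = 1).

Let Bea u : u \in a -> B u e = 0.
Proof. by move=> ua; rewrite scalarC; apply: (mem_orthovP e_orth). Qed.

(** As <e, e> is non-zero, e lies outside [a], and codimension one makes [a] and e span
    everything. *)
Let decompose x : exists2 u, u \in a & exists k, x = u + k *: e.
Proof.
have e_a : e \notin a.
  apply/negP => /Bea e0; move/eqP: eps2.
  by rewrite e0 mul0r eq_sym oner_eq0.
have full : (a + <[e]>)%VS = fullv.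
  apply/eqP; rewrite eqEdim subvf -a_codim.
  rewrite dimv_disjoint_sum; last first.
    apply/eqP; rewrite -subv0; apply/subvP => v /memv_capP[va /vlineP[k vE]].
    move: va; rewrite vE rpredZeq (negPf e_a) orbF => /eqP->.
    by rewrite scale0r mem0v.
  have e0 : e != 0 by apply: contraNneq e_a => ->; apply: mem0v.
  by rewrite dim_vline e0 addn1 leqnn.
have /memv_addP[u ua [_ /vlineP[k ->] ->]] : x \in (a + <[e]>)%VS.
  by rewrite full memvf.
by exists u => //; exists k.
Qed.

Lemma ad_orthogonal x : B (ad e x) e = 0.
Proof.
have [u ua [k ->]] := decompose x; rewrite adE linearDr linearZr_LR /= liexx.
by rewrite scaler0 addr0; apply: Bea; apply: a_ideal.1.
Qed.

(** For x = u + k e and y = v + l e, commutativity of [a] leaves k [e, v] - l [e, u], and <x, e> = k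
    <e, e> recovers k since <e, e> squares to 1; likewise for l. *)
Lemma lie_ad x y :
  lie x y = B e e *: (B x e *: ad e y - B y e *: ad e x).
Proof.
have [u ua [k ->]] := decompose x; have [v va [l ->]] := decompose y.
rewrite !adE !scalarE (Bea ua) (Bea va) !add0r.
rewrite !(linearDr, linearDl, linearZr_LR, linearZl_LR) /= liexx !scaler0 !addr0.
rewrite (a_ideal.2 _ _ ua va) (lieC u e) add0r scalerBr !scalerA.
by rewrite !(mulrCA (B e e)) eps2 !mulr1 scalerN addrC.
Qed.

End NondegenerateIdeal.

Theorem theorem5p1 (R : realType) (n : nat) (g : lieAlgType R)
    (B : scalar_product g) (a : {vspace g}) (e : g)
    (dim_g : \dim {:g} = n)
    (g_almost_abelian : almost_abelian g)
    (a_abelian_ideal : abelian_ideal a)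
    (a_codim : codim_one a)
    (a_nondegenerate : nondegenerate_on B a)
    (e_generator : orthov B a = <[e]>%VS)
    (e_unit : B e e = 1 \/ B e e = -1)
    (ad_e_sym : sym_part B (ad e) <> 0) :
  associative (LC_sym B) <->
  (3 <= n)%N /\
  exists (s : bool) (C : scalar_product (abelian_alg R (n - 3))),
    isometrically_isomorphic B (orthosum (heisenberg_metric R s) C) /\
    signature (orthosum (heisenberg_metric R s) C) = signature B.
Proof.
have e_orth : e \in orthov B a by rewrite e_generator memv_line.
have eps2 : B e e * B e e = 1 by case: e_unit => ->; rewrite ?mulrNN mulr1.
split=> [assocU | [_ [s [C [iso _]]]]]; last first.
  exact: LC_sym_associative_isometry iso (@heisenberg_LC_sym_associative _ _ _ _).
have [n3 [s [C iso]]] := associative_heisenberg eps2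
  (ad_orthogonal a_abelian_ideal a_codim e_orth eps2)
  (lie_ad a_abelian_ideal a_codim e_orth eps2) assocU ad_e_sym dim_g.
split=> //; exists s, C; split=> //; exact: isometric_signature iso.
Qed.
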